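(* Let $R$ be a ring and let $M$ be a left $R$-module such that $G(M)$ is infinite and $\omega(M)<\infty$. Then $\omega(M)=\chi(M)$.
   Context: Rings are associative with unity and modules are unitary left modules. A nontrivial submodule of $M$ is a submodule different from $0$ and $M$. The intersection graph $G(M)$ is the simple graph whose vertices are the nontrivial submodules of $M$, two distinct vertices being adjacent iff their intersection is nonzero; it is infinite if its vertex set is. $\omega(M)$ is the clique number of $G(M)$, i.e. the supremum of the cardinalities of its cliques (sets of pairwise adjacent vertices). $\chi(M)$ is the chromatic number of $G(M)$, i.e. the least cardinality of a set of colors admitting a coloring of the vertices in which adjacent vertices get different colors. *)

(* Defs.v *)
From HB Require Import structures.
From mathcomp Require Import all_boot all_order all_algebra.
From mathcomp Require Import boolp classical_sets functions cardinality.

Set Implicit Arguments.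
Unset Strict Implicit.
Unset Printing Implicit Defensive.

Local Open Scope classical_set_scope.
Local Open Scope ring_scope.
Local Open Scope card_scope.

Record simple_graph := SimpleGraph {
  vertex : Type;
  adj : vertex -> vertex -> Prop;
  adj_sym : forall x y, adj x y -> adj y x;
  adj_irr : forall x, ~ adj x x }.

(* Cardinals, possibly infinite, are represented by types: the type K stands
   for its own cardinality, and cardinals are compared with #<=. *)

Definition clique (G : simple_graph) (Q : set (vertex G)) : Prop :=
  forall x y, Q x -> Q y -> x <> y -> adj x y.

Definition bounds_cliques (G : simple_graph) (K : Type) : Prop :=
  forall Q : set (vertex G), clique Q -> Q #<= [set: K].

(* omega(G) = |K|: least upper bound of the cardinalities of the cliques. *)
Definition is_clique_number (G : simple_graph) (K : Type) : Prop :=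
  bounds_cliques G K /\
  forall L : Type, bounds_cliques G L -> [set: K] #<= [set: L].

Definition colorable (G : simple_graph) (K : Type) : Prop :=
  exists c : vertex G -> K, forall x y, adj x y -> c x <> c y.

(* chi(G) = |K|: least cardinality of a set of colors admitting a coloring. *)
Definition is_chromatic_number (G : simple_graph) (K : Type) : Prop :=
  colorable G K /\
  forall L : Type, colorable G L -> [set: K] #<= [set: L].

Section IntersectionGraph.
Variables (R : pzRingType) (M : lmodType R).

Definition nontrivial_submodule (N : set M) : Prop :=
  [/\ GRing.submod_closed (mem N), N <> [set 0] & N <> setT].

Definition nontrivial_submodules : set (set M) :=
  [set N | nontrivial_submodule N].

Definition meets (N L : nontrivial_submodules) : Prop :=
  N <> L /\ val N `&` val L <> [set 0].

Lemma meets_sym N L : meets N L -> meets L N.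
Proof. by case=> neNL NL0; split; [exact: nesym | rewrite setIC]. Qed.

Lemma meets_irr N : ~ meets N N.
Proof. by case. Qed.

Definition intersection_graph : simple_graph :=
  SimpleGraph meets_sym meets_irr.

End IntersectionGraph.

(* Main.v *)
(* Chains of submodules, and the sets of nontrivial submodules containing a given
   nonzero submodule, are cliques. When cliques have bounded size, every nonzero
   submodule thus contains a simple one, and each simple submodule lies in finitely
   many submodules, so there are infinitely many simple submodules. Fixing a simple
   S, infinitely many of the sums S + T, T simple, coincide with one submodule N,
   and N contains every simple submodule. The nontrivial submodules containing N
   meet all the others; two submodules not containing N have simple traces on N and
   meet if and only if these traces coincide. So the graph is the join of a finite
   clique with a disjoint union of cliques, for which omega = chi. *)

Require Import Defs.
From mathcomp Require Import all_boot all_order all_algebra.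
From mathcomp Require Import boolp classical_sets functions cardinality.

Local Open Scope classical_set_scope.

(** * Cliques and colorings of graphs *)

Section Coloring.
Local Open Scope card_scope.

Lemma size_le_card_ord (T : eqType) (s : seq T) (n : nat) :
  uniq s -> [set` s] #<= [set: 'I_n] -> size s <= n.
Proof.
move=> us; rewrite (card_le_eqr (card_esym card_II)) => /pcard_leP[f].
rewrite -[leqLHS](size_map f) -[leqRHS](size_iota 0 n); apply: uniq_leq_size.
  by rewrite map_inj_in_uniq// => x y xs ys; apply: inj; rewrite inE.
by move=> _ /mapP[x xs ->]; rewrite mem_iota; exact: (@funS _ _ _ _ f x xs).
Qed.

Lemma bounds_cliques_finite (G : simple_graph) (n : nat) (Q : set (vertex G)) :
  bounds_cliques G 'I_n -> clique Q -> finite_set Q.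
Proof. by move=> + cQ => /(_ Q cQ) /card_le_finite; apply; exact: finite_finset. Qed.

(** A coloring is injective on each clique. This is the inequality between clique number and
    chromatic number that holds in every graph. *)
Lemma colorable_bounds_cliques (G : simple_graph) (K : Type) :
  colorable G K -> bounds_cliques G K.
Proof.
move=> [c cP] Q cQ.
have ci : {in Q &, injective c}.
  move=> x y /set_mem Qx /set_mem Qy cxy; apply: contrapT => xy.
  exact: cP (cQ _ _ Qx Qy xy) cxy.
by rewrite -(card_le_eql (inj_card_eq ci)); exact: subset_card_le.
Qed.

(* The graphs described here are joins of a clique [F] with a disjoint union of
   cliques, the fibers of [key] outside [F]. *)
Lemma colorable_join_cliques (G : simple_graph) (n : nat) (K : Type)
    (F : set (vertex G)) (key : vertex G -> K) :
    bounds_cliques G 'I_n ->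
    (forall k, clique (F `|` (key @^-1` [set k] `\` F))) ->
    (forall x y, ~ F x -> ~ F y -> adj x y -> key x = key y) ->
  colorable G 'I_n.
Proof.
move=> bG cliqueF keyP; pose V : eqType := {classic vertex G}.
have seqP (A : set V) : finite_set A -> exists2 s : seq V, uniq s & A = [set` s].
  move=> /finite_seqP[s ->]; exists (undup s); first exact: undup_uniq.
  by apply/seteqP; split=> x /=; rewrite mem_undup.
have finP k : finite_set F /\ finite_set (key @^-1` [set k] `\` F).
  by rewrite -finite_setU; exact: bounds_cliques_finite _ _ _ bG (cliqueF k).
have /choice[t tP] k : exists t : seq V,
    uniq t /\ key @^-1` [set k] `\` F = [set` t].
  by have [t] := seqP _ (finP k).2; exists t.
(* A vertex [x0] supplies a default for [nth] and a key, without which [finP] says nothing about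
   [F]. *)
case: (pselect (exists x : vertex G, True)) => [[x0 _]|noV]; last first.
  by exists (fun x => False_rect _ (noV (ex_intro _ x I))) => x; case: noV; exists x.
have [s us Fs] := seqP _ (finP (key x0)).1.
have Fin x : F x <-> x \in s by rewrite Fs.
have tin k x : (key x = k /\ ~ F x) <-> x \in t k.
  by have [_ /seteqP[h1 h2]] := tP k; split=> [/h1|/h2].
have st_n k : size s + size (t k) <= n.
  rewrite -size_cat; apply: size_le_card_ord.
    rewrite cat_uniq us (tP k).1 andbT /=; apply/hasPn => x /tin[_ nFx].
    by apply/negP => /Fin.
  suff -> : [set` s ++ t k] = F `|` (key @^-1` [set k] `\` F).
    exact: bG (cliqueF k).
  rewrite (tP k).2 Fs; apply/seteqP; split=> x /=; rewrite mem_cat.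
    by move=> /orP[]; [left|right].
  by move=> [->|->]; rewrite ?orbT.
(* The color of [x] is its position in an enumeration of [F] followed by one of its own fiber:
   positions below [size s] are reserved for [F], the later ones are reused by all fibers. *)
pose c (x : V) := index x (s ++ t (key x)).
have in_st (x : V) : x \in s ++ t (key x).
  rewrite mem_cat; case: (pselect (F x)) => [/Fin -> //|nFx].
  by rewrite (proj1 (tin _ x)) ?orbT.
have c_n x : c x < n.
  apply: leq_trans (st_n (key x)).
  by rewrite -size_cat index_mem in_st.
exists (fun x => Ordinal (c_n x)) => x y xy /(congr1 val) /= cxy.
suff exy : x = y by rewrite exy in xy; exact: adj_irr xy.
have nthst (z : V) : nth (x0 : V) (s ++ t (key z)) (c z) = z by rewrite /c nth_index.
have ltF (z : V) : (c z < size s) = (z \in s).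
  rewrite /c index_cat; case: ifP => [|_]; first by rewrite index_mem.
  by apply/negbTE; rewrite -leqNgt leq_addr.
have [xs|xs] := boolP (x \in s).
  have ys : y \in s by rewrite -ltF -cxy ltF.
  rewrite -(nthst x) -(nthst y) !nth_cat !ltF xs.
  by rewrite ys cxy.
have ys : y \notin s by rewrite -ltF -cxy ltF.
have kxy : key x = key y.
  by apply: keyP xy; [apply/Fin/negP|apply/Fin/negP].
by rewrite -(nthst x) -(nthst y) cxy kxy.
Qed.

End Coloring.

(** * Simple submodules and their sums *)

Section Submodules.
Local Open Scope ring_scope.
Context {R : pzRingType} {M : lmodType R}.
Implicit Types A B X Y N S T U : set M.

Definition submodule X : Prop := X 0 /\ forall a u v, X u -> X v -> X (a *: u + v).

Definition simple U : Prop :=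
  [/\ submodule U, U <> [set 0] &
      forall X, submodule X -> X `<=` U -> X <> [set 0] -> X = U].

Definition sum A B : set M := [set a + b | a in A & b in B].

Lemma submod_closedP X : GRing.submod_closed (mem X) <-> submodule X.
Proof.
split=> [[X0 XD]|[X0 XD]]; split.
- by rewrite -inE.
- by move=> a u v Xu Xv; rewrite -inE; apply: XD; rewrite inE.
- by rewrite inE.
- by move=> a u v; rewrite !inE; exact: XD.
Qed.

Lemma submoduleD X x y : submodule X -> X x -> X y -> X (x + y).
Proof. by case=> _ XD Xx Xy; rewrite -[x]GRing.scale1r; exact: XD. Qed.

Lemma submoduleB X x y : submodule X -> X x -> X y -> X (x - y).
Proof. by case=> _ XD Xx Xy; rewrite -GRing.scaleN1r GRing.addrC; exact: XD. Qed.

Lemma submodule_neq0 X :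
  submodule X -> X <> [set 0] -> exists2 x, X x & x <> 0.
Proof.
move=> [X0 _] nX; apply: contrapT => h; apply: nX; apply/seteqP.
split=> [x Xx|_ ->//]; apply: contrapT => x0; apply: h; by exists x.
Qed.

Lemma neq0_set X x : X x -> x <> 0 -> X <> [set 0].
Proof. by move=> Xx x0 X0; rewrite X0 in Xx. Qed.

Lemma submodule_setI X Y : submodule X -> submodule Y -> submodule (X `&` Y).
Proof.
by move=> [X0 XD] [Y0 YD]; split=> // a u v [? ?] [? ?]; split; [exact: XD|exact: YD].
Qed.

Lemma submodule_sum X Y : submodule X -> submodule Y -> submodule (sum X Y).
Proof.
move=> [X0 XD] [Y0 YD]; split.
  by exists 0 => //; exists 0 => //; rewrite GRing.addr0.
move=> a _ _ [x Xx [y Yy <-]] [x' Xx' [y' Yy' <-]].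
exists (a *: x + x'); first exact: XD.
by exists (a *: y + y'); [exact: YD|rewrite GRing.scalerDr GRing.addrACA].
Qed.

Lemma sub_suml X Y : submodule Y -> X `<=` sum X Y.
Proof. by move=> [Y0 _] x Xx; exists x => //; exists 0 => //; rewrite GRing.addr0. Qed.

Lemma sub_sumr X Y : submodule X -> Y `<=` sum X Y.
Proof. by move=> [X0 _] y Yy; exists 0 => //; exists y => //; rewrite GRing.add0r. Qed.

Lemma sum_sub X Y N : submodule N -> X `<=` N -> Y `<=` N -> sum X Y `<=` N.
Proof.
by move=> smN XN YN _ [x /XN Nx [y /YN Ny <-]]; exact: submoduleD.
Qed.

Lemma sumC X Y : sum X Y = sum Y X.
Proof.
by apply/seteqP; split=> _ [x Xx [y Yy <-]]; exists y => //; exists x => //;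
  rewrite GRing.addrC.
Qed.

(* The modular law, in the case where the intersection of [U] with [N] is zero. *)
Lemma sum_setIK X U N : submodule X -> submodule U -> submodule N ->
  X `<=` N -> U `&` N = [set 0] -> sum X U `&` N = X.
Proof.
move=> smX smU smN XN UN; apply/seteqP; split.
  move=> _ [[x Xx [u Uu <-]] Nxu].
  have -> : u = 0; last by rewrite GRing.addr0.
  suff : (U `&` N) u by rewrite UN.
  split=> //; rewrite -(GRing.addKr x u) GRing.addrC.
  by apply: submoduleB => //; exact: XN.
by move=> x Xx; split; [exact: sub_suml|exact: XN].
Qed.

Lemma simple_setI U X : simple U -> submodule X -> ~ (U `<=` X) ->
  U `&` X = [set 0].
Proof.
move=> [smU U0 minU] smX nUX; apply: contrapT => UX0; apply: nUX.
rewrite -(minU (U `&` X)) //; first exact: submodule_setI.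
Qed.

(** The sum of two simple submodules has length at most 2, which leaves no room strictly between a
    simple submodule and the whole sum. *)
Lemma simple_in_sum S T U X : simple S -> simple T -> simple U -> submodule X ->
  U `<=` X -> X `<=` sum S T -> ~ (sum S T `<=` X) -> X = U.
Proof.
(* [X] fails to contain one of the two summands, whose roles are symmetric. *)
wlog nSX : S T / ~ (S `<=` X).
  move=> wl simS simT simU smX UX XST nSTX.
  case: (pselect (S `<=` X)) => [SX|nSX]; last exact: (wl S T).
  apply: (wl T S) => //; rewrite 1?sumC // => TX; apply: nSTX.
  exact: sum_sub.
move=> simS simT simU smX UX XST nSTX.
have [smS _ _] := simS; have [smT _ _] := simT; have [smU U0 _] := simU.
have SX : S `&` X = [set 0] by exact: simple_setI.
have smSU := submodule_sum _ _ smS smU.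
(* Otherwise [T] meets [sum S U] in 0. A nonzero [u] of [U] is some [s + t], and [t = u - s] must
   vanish, so [u] lies in both [S] and [X], which meet in 0. *)
have TSU : T `<=` sum S U.
  apply: contrapT => /(simple_setI _ _ simT smSU) TSU.
  have [u Uu u0] := submodule_neq0 _ smU U0.
  have [s Ss [t Tt stu]] := XST _ (UX _ Uu).
  have t0 : t = 0.
    suff : (T `&` sum S U) t by rewrite TSU.
    split=> //; rewrite -(GRing.addKr s t) stu GRing.addrC.
    by apply: submoduleB => //; [exact: sub_sumr|exact: sub_suml].
  apply: u0; suff : (S `&` X) u by rewrite SX.
  by split; [rewrite -stu t0 GRing.addr0|exact: UX].
apply/seteqP; split=> // x Xx.
(* Now [x = s + s' + u], so [x - u] lies in both [S] and [X]. *)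
have [s Ss [t /TSU [s' Ss' [u Uu <-]] xE]] := XST _ Xx.
have -> : x = u => //; apply: GRing.subr0_eq.
suff : (S `&` X) (x - u) by rewrite SX.
split; last by apply: submoduleB => //; exact: UX.
by rewrite -xE GRing.addrA GRing.addrK; exact: submoduleD.
Qed.

End Submodules.

(** * Modules whose intersection graph has bounded cliques *)

Section FiniteCliqueNumber.
Local Open Scope ring_scope.
Context {R : pzRingType} {M : lmodType R} {n : nat}.
Hypothesis bounded : bounds_cliques (intersection_graph M) 'I_n.
Implicit Types A B X Y N S T U : set M.

Lemma finite_pairwise_meeting (Q : set (set M)) :
  Q `<=` @nontrivial_submodules R M ->
  (forall X Y, Q X -> Q Y -> X `&` Y <> [set 0]) -> finite_set Q.
Proof.
move=> Qnt Qmeet.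
pose Q' : set (vertex (intersection_graph M)) := val @^-1` Q.
have cQ' : clique Q' by move=> x y Qx Qy xy; split=> //; exact: Qmeet.
apply: sub_finite_set (finite_image val (bounds_cliques_finite _ _ _ bounded cQ')).
by move=> X QX; exists (SigSub (mem_set (Qnt _ QX))).
Qed.

(** All these submodules share [U], so the proper ones form a clique; the whole module is not a
    vertex and is added separately. *)
Lemma finite_overmodules U : submodule U -> U <> [set 0] ->
  finite_set [set X | submodule X /\ U `<=` X].
Proof.
move=> smU U0; have [u Uu u0] := submodule_neq0 _ smU U0.
apply: (@sub_finite_set _ _
    ([set X | [/\ submodule X, U `<=` X & X <> setT]] `|` [set setT])).
  move=> X [smX UX]; case: (pselect (X = setT)) => XT; first by right.
  by left; split.
rewrite finite_setU; split; last exact: finite_set1.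
apply: finite_pairwise_meeting.
  move=> X [smX UX XT]; split=> //; first exact/submod_closedP.
  exact: neq0_set (UX _ Uu) u0.
move=> X Y [_ UX _] [_ UY _]; apply: (neq0_set _ u) => //.
by split; [exact: UX|exact: UY].
Qed.

(* Otherwise there is an infinite descending chain of submodules, which is an
   infinite clique. *)
Lemma exists_simple X : submodule X -> X <> [set 0] ->
  exists2 U, simple U & U `<=` X.
Proof.
move=> smX X0; apply: contrapT => noU.
pose P Y := [/\ submodule Y, Y <> [set 0] & Y `<=` X].
have /choice[f fP] Y : exists Z, P Y -> [/\ P Z, Z `<=` Y & Z <> Y].
  case: (pselect (P Y)) => [[smY Y0 YX]|nPY]; last by exists Y.
  apply: contrapT => noZ; apply: noU; exists Y => //; split=> // Z smZ ZY Z0.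
  apply: contrapT => nZY; apply: noZ; exists Z => _; split=> //.
  by split=> //; exact: subset_trans YX.
pose c k := iter k f X.
have Pc k : P (c k) by elim: k => [|k /fP[] //]; split.
have cS k : c k.+1 `<=` c k /\ c k.+1 <> c k by have [] := fP _ (Pc k).
have cle i j : (i <= j)%N -> c j `<=` c i.
  move=> /subnK <-; elim: (j - i)%N => [//|d IH].
  by rewrite addSn; exact: subset_trans (cS _).1 IH.
have clt i j : (i < j)%N -> c j <> c i.
  move=> ij cji; apply: (cS i).2; apply/seteqP; split; first exact: (cS i).1.
  by rewrite -cji; exact: cle.
(* Indices start at 1 because [c 0 = X] may be the whole module, which is not a vertex. *)
have cinj : injective (fun k => c k.+1).
  move=> i j cij; case: (ltngtP i j) => // ij; exfalso.
    exact: (clt i.+1 j.+1).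
  exact: (clt j.+1 i.+1).
have : finite_set (range (fun k => c k.+1)).
  apply: finite_pairwise_meeting.
    move=> _ [k _ <-]; have [smc c0 _] := Pc k.+1; split=> //.
      exact/submod_closedP.
    move=> cT; apply: (cS k).2; rewrite cT; apply/seteqP; split=> // x _.
    by apply: (cS k).1; rewrite cT.
  move=> _ _ [i _ <-] [j _ <-].
  wlog ij : i j / (i <= j)%N.
    by move=> wl; case: (leqP i j) => [|/ltnW] /wl //; rewrite setIC.
  by rewrite setIC (setIidl (cle i.+1 j.+1 ij)); case: (Pc j.+1).
rewrite (eq_finite_set (inj_card_eq (in2W cinj))).
exact: infinite_nat.
Qed.

Hypothesis infG : infinite_set [set: vertex (intersection_graph M)].

Lemma infinite_simple : infinite_set [set U : set M | simple U].
Proof.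
move=> finU; apply: infG.
have fin : finite_set (@nontrivial_submodules R M).
  apply: (@sub_finite_set _ _
    (\bigcup_(U in [set U | simple U]) [set X | submodule X /\ U `<=` X])).
    move=> X [/submod_closedP smX X0 _].
    by have [U simU UX] := exists_simple _ smX X0; exists U.
  by apply: bigcup_finite => // U [smU U0 _]; exact: finite_overmodules.
have := @finite_preimage _ _ _ (val : vertex (intersection_graph M) -> set M)
  (in2W val_inj) fin.
by apply: sub_finite_set => x _; exact: set_valP.
Qed.

(** Pigeonhole: there are infinitely many simple [T], but every [sum S T] is among the finitely many
    submodules containing [S]. *)
Lemma sum_of_infinitely_many : exists2 S, simple S &
  exists N, infinite_set [set T | simple T /\ sum S T = N].
Proof.
have [S simS] := infinite_setN0 infinite_simple; exists S => //.
have [smS S0 _] := simS.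
apply: contrapT => noN; apply: infinite_simple.
apply: (@sub_finite_set _ _ (\bigcup_(N in [set X | submodule X /\ S `<=` X])
    [set T | simple T /\ sum S T = N])).
  move=> T simT; have [smT _ _] := simT; exists (sum S T) => //.
  by split; [exact: submodule_sum|exact: sub_suml].
apply: bigcup_finite; first exact: finite_overmodules.
by move=> N _; apply: contrapT => infN; apply: noN; exists N.
Qed.

(* Were [U] outside [N], the submodules [T + U] would be distinct by the modular
   law, and all contain [U]. *)
Lemma simple_sub_sum S N U : simple S ->
  infinite_set [set T | simple T /\ sum S T = N] -> simple U -> U `<=` N.
Proof.
move=> simS infN simU; apply: contrapT => nUN.
have [smS _ _] := simS; have [smU U0 _] := simU.
have smN : submodule N.
  by have [T [[smT _ _] <-]] := infinite_setN0 infN; exact: submodule_sum.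
apply: infN; apply: sub_finite_set
  (finite_image (fun X => X `&` N) (finite_overmodules _ smU U0)).
move=> T [[smT _ _] STN]; exists (sum T U).
  by split; [exact: submodule_sum|exact: sub_sumr].
apply: sum_setIK => //; first by rewrite -STN; exact: sub_sumr.
exact: simple_setI.
Qed.

Lemma colorable_clique_number : colorable (intersection_graph M) 'I_n.
Proof.
have [S simS [N infN]] := sum_of_infinitely_many.
have [T [simT STN]] := infinite_setN0 infN.
have [[smS _ _] [smT _ _]] := (simS, simT).
have smN : submodule N by rewrite -STN; exact: submodule_sum.
have inN U (simU : simple U) : U `<=` N := simple_sub_sum _ _ _ simS infN simU.
have smv (x : vertex (intersection_graph M)) : submodule (val x) /\ val x <> [set 0].
  by have [/submod_closedP] := set_valP x.
(* [N] is a sum of two simple submodules, so [simple_in_sum] applies to the trace of [X] on [N]. *)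
have traceP X U : submodule X -> simple U -> U `<=` X -> ~ N `<=` X -> X `&` N = U.
  move=> smX simU UX nNX; apply: (simple_in_sum S T) => //.
  - exact: submodule_setI.
  - by move=> x Ux; split; [exact: UX|exact: inN Ux].
  - by rewrite STN.
  - by rewrite STN => h; apply: nNX => x /h[].
pose F : set (vertex (intersection_graph M)) := [set x | N `<=` val x].
apply: (@colorable_join_cliques _ _ _ F (fun x => val x `&` N) bounded).
  have meetN (x : vertex (intersection_graph M)) : val x `&` N <> [set 0].
    have [smx x0] := smv x; have [U simU Ux] := exists_simple _ smx x0.
    have [smU U0 _] := simU; have [u Uu u0] := submodule_neq0 _ smU U0.
    by apply: (neq0_set _ u) => //; split; [exact: Ux|exact: inN Uu].
  (* The trace of [x] on [N] is nonzero, so [y] meets [x] as soon as it contains this trace. This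
     covers both a [y] containing [N] and a [y] with the same trace. *)
  have meet (x y : vertex (intersection_graph M)) :
      val x `&` N `<=` val y -> val x `&` val y <> [set 0].
    have smxN : submodule (val x `&` N) by exact: submodule_setI (smv x).1 smN.
    have [z xNz z0] := submodule_neq0 _ smxN (meetN x).
    by move=> xNy; apply: neq0_set z0; split; [case: xNz|exact: xNy].
  move=> k x y [Fx|[xk nFx]] [Fy|[yk nFy]] xy; split=> //.
  - by apply: meet => z [_ /Fy].
  - by rewrite setIC; apply: meet => z [_ /Fx].
  - by apply: meet => z [_ /Fy].
  - by apply: meet; rewrite xk -yk => z [].
move=> x y nFx nFy [_ xy0].
(* A simple submodule of the intersection is the trace on [N] of both vertices. *)
have smxy : submodule (val x `&` val y) by apply: submodule_setI; exact: (smv _).1.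
have [U simU Uxy] := exists_simple _ smxy xy0.
rewrite (traceP (val x) U) ?(traceP (val y) U) //; try exact: (smv _).1.
  by move=> z /Uxy[].
by move=> z /Uxy[].
Qed.

End FiniteCliqueNumber.

Theorem theorem4p3 (R : pzRingType) (M : lmodType R)
    (infG : infinite_set [set: vertex (intersection_graph M)])
    (omega_fin : exists n : nat, is_clique_number (intersection_graph M) 'I_n) :
  exists n : nat,
    is_clique_number (intersection_graph M) 'I_n /\
    is_chromatic_number (intersection_graph M) 'I_n.
Proof.
have [n omega_n] := omega_fin; exists n; split=> //.
have [bounded least] := omega_n; split; first exact: colorable_clique_number.
(* Any set of colors bounds the cliques, hence is at least as large as their least bound. *)
by move=> L /colorable_bounds_cliques /least.
Qed.
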